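(* For any $p\in[1,\infty)$, the Banach ring $L^{\bullet}(\ell_p)$ is not Hirsch.
   Context: Let $\mathbb F$ be the field of real or complex numbers. For $p\in[1,\infty)$, $\ell_p$ is the Banach space of all functions $x:\omega\to\mathbb F$ with finite norm $\|x\|_{\ell_p}=\big(\sum_{n\in\omega}|x(n)|^p\big)^{1/p}$. $L(\ell_p)$ is the Banach space of bounded linear operators on $\ell_p$ with the operator norm $\|a\|=\sup\{\|a(x)\|_{\ell_p}:x\in\ell_p,\ \|x\|_{\ell_p}\le1\}$. $L^{\bullet}(\ell_p)$ is the Banach ring $L(\ell_p)$ endowed with the multiplication $\bullet$ defined by $(a\bullet b)(x)=b(a(x))$ for $a,b\in L(\ell_p)$, $x\in\ell_p$. A series $\sum_{n\in\omega}x_n$ in an Abelian topological group $G$ unconditionally converges to $x\in G$ if for any neighborhood $U$ of $0$ there is a finite set $F\subset\omega$ such that $\sum_{i\in J}x_i\in x+U$ for any finite set $J\subset\omega$ containing $F$; it is unconditionally convergent if it unconditionally converges to some $x\in G$. A topological ring $R$ (with product $ax$ of $a,x\in R$) is Hirsch if for any unconditionally convergent series $\sum_{n\in\omega}x_n$ in $R$ and any neighborhood $U\subseteq R$ of $0$ there exists a neighborhood $V\subseteq R$ of $0$ such that $\sum_{n\in F}a_nx_n\in U$ for any finite set $F\subset\omega$ and any sequence $(a_n)_{n\in F}\in V^F$. *)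

(* Defs.v *)
From HB Require Import structures.
From mathcomp Require Import all_boot all_order all_algebra finmap.
From mathcomp Require Import complex.
From mathcomp Require Import all_classical all_reals all_analysis.
Import Order.TTheory GRing.Theory Num.Theory.
Import numFieldNormedType.Exports.

Set Implicit Arguments.
Unset Strict Implicit.
Unset Printing Implicit Defensive.

Local Open Scope classical_set_scope.
Local Open Scope ring_scope.

HB.mixin Record isTopologicalRing T & Topological T & GRing.PzRing T := {
  mulr_continuous : continuous (fun z : T * T => z.1 * z.2)
}.

#[short(type="topologicalRingType")]
HB.structure Definition TopologicalRing :=
  {T of TopologicalZmodule T & GRing.PzRing T & isTopologicalRing T}.

Definition unconditionally_converges (G : topologicalZmodType)
    (x : nat -> G) (l : G) : Prop :=
  forall U : set G, nbhs 0 U ->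
    exists F : {fset nat}, forall J : {fset nat}, (F `<=` J)%fset ->
      [set l + u | u in U] (\sum_(i <- J) x i).

Definition unconditionally_convergent (G : topologicalZmodType)
    (x : nat -> G) : Prop :=
  exists l : G, unconditionally_converges x l.

(* The values of [a] outside [F] are irrelevant, so total sequences stand for
   the elements of V^F. *)
Definition Hirsch (T : topologicalRingType) : Prop :=
  forall x : nat -> T, unconditionally_convergent x ->
  forall U : set T, nbhs 0 U ->
  exists2 V : set T, nbhs 0 V &
    forall (F : {fset nat}) (a : nat -> T),
      (forall n, n \in F -> V (a n)) -> U (\sum_(n <- F) a n * x n).

Variant scalar_kind := RealScalars | ComplexScalars.

Definition scalar (R : realType) (k : scalar_kind) : numFieldType :=
  match k with
  | RealScalars => R
  | ComplexScalars => R[i]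
  end.

(* The absolute value with values in [R]; the norm [`|z|] that the library puts
   on [R[i]] is [R[i]]-valued. *)
Definition modulus (R : realType) (k : scalar_kind) : scalar R k -> R :=
  match k with
  | RealScalars => fun x : R => `|x|
  | ComplexScalars => fun z : R[i] => complex.Re `|z|
  end.

Import ComplexField.

Section modulus_theory.
Context {R : realType} {k : scalar_kind}.
Implicit Types x y : scalar R k.

Lemma modulus_complexE (z : R[i]) :
  @modulus R ComplexScalars z = Normc.normc z.
Proof. by case: z. Qed.

Lemma modulus_ge0 x : 0 <= modulus x.
Proof.
case: k x => x; first exact: normr_ge0.
by rewrite modulus_complexE; case: x => ? ?; exact: sqrtr_ge0.
Qed.

Lemma modulusD x y : modulus (x + y) <= modulus x + modulus y.
Proof.
case: k x y => x y; first exact: ler_normD.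
by rewrite !modulus_complexE; exact: le_normcD.
Qed.

Lemma modulusM x y : modulus (x * y) = modulus x * modulus y.
Proof.
case: k x y => x y; first exact: normrM.
by rewrite !modulus_complexE; exact: Normc.normcM.
Qed.

Lemma modulus_eq0 x : modulus x = 0 -> x = 0.
Proof.
case: k x => x; first exact: normr0_eq0.
by rewrite modulus_complexE; exact: Normc.eq0_normc.
Qed.

Lemma modulus0 : modulus (0 : scalar R k) = 0.
Proof.
case: k; first exact: normr0.
by rewrite modulus_complexE Normc.normc0.
Qed.

Lemma modulusN x : modulus (- x) = modulus x.
Proof.
case: k x => x; first exact: normrN.
by rewrite !modulus_complexE normcN.
Qed.

Lemma modulus1 : modulus (1 : scalar R k) = 1.
Proof.
case: k; first exact: normr1.
by rewrite modulus_complexE Normc.normc1.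
Qed.

Lemma modulus_natr n : modulus (n%:R : scalar R k) = n%:R.
Proof.
case: k; first exact: normr_nat.
rewrite modulus_complexE -[1]/(1%:C)%C -rmorphMn /=.
by rewrite expr0n addr0 sqrtr_sqr normr_nat.
Qed.
End modulus_theory.

HB.lock Definition lp_enorm (R : realType) (k : scalar_kind) (p : R)
    (x : nat -> scalar R k) : \bar R :=
  ((\sum_(n <oo) (modulus (x n) `^ p)%:E) `^ p^-1)%E.

(* The proof [p1] is a phantom parameter of [finite_lp_norm] and [lp]: it lets
   canonical structures find the hypothesis [1 <= p]. *)
Definition finite_lp_norm (R : realType) (k : scalar_kind) (p : R)
    (p1 : 1 <= p) : {pred nat -> scalar R k} :=
  fun x => `[< (lp_enorm p x < +oo)%E >].

Record lp (R : realType) (k : scalar_kind) (p : R) (p1 : 1 <= p) :=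
  Lp { lp_fun :> nat -> scalar R k; _ : lp_fun \in @finite_lp_norm R k p p1 }.

Section lp_space.
Context {R : realType} {k : scalar_kind} {p : R} {p1 : 1 <= p}.
Local Notation F := (scalar R k).
Local Notation finite_lp_norm := (@finite_lp_norm R k p p1).
Local Notation lp := (@lp R k p p1).
Local Notation lp_enorm := (@lp_enorm R k p).

HB.instance Definition _ := [isSub of lp for @lp_fun R k p p1].
HB.instance Definition _ := [Equality of lp by <:].
HB.instance Definition _ := [Choice of lp by <:].

Let p0 : 0 < p. Proof. exact: lt_le_trans p1. Qed.

Lemma lp_enormE x :
  lp_enorm x = Lnorm counting p%:E (EFin \o (@modulus R k \o x)).
Proof.
rewrite Lnorm_counting// lp_enorm.unlock; congr (_ `^ _)%E.
by apply: eq_eseriesr => n _ /=; rewrite ger0_norm ?modulus_ge0.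
Qed.

Lemma lp_enorm_ge0 x : (0 <= lp_enorm x)%E.
Proof. by rewrite lp_enorm.unlock poweR_ge0. Qed.

Lemma lp_enormD (x y : nat -> F) :
  (lp_enorm (x + y)%R <= lp_enorm x + lp_enorm y)%E.
Proof.
rewrite !lp_enormE.
apply: le_trans; last exact: minkowski_EFin.
rewrite !Lnorm_counting//.
apply: gt0_ler_poweR.
- by rewrite invr_ge0 ltW.
- rewrite in_itv/= leey andbT; apply: nneseries_ge0 => n _ _.
  by rewrite lee_fin powR_ge0.
- rewrite in_itv/= leey andbT; apply: nneseries_ge0 => n _ _.
  by rewrite lee_fin powR_ge0.
apply: lee_nneseries => n _; first by move=> _; exact: poweR_ge0.
rewrite /= lee_fin !ger0_norm ?addr_ge0 ?modulus_ge0//.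
apply: ge0_ler_powR; rewrite ?nnegrE ?addr_ge0 ?modulus_ge0 ?(ltW p0)//.
exact: modulusD.
Qed.

Lemma lp_enormZ a (x : nat -> F) :
  lp_enorm (a *: x) = ((modulus a)%:E * lp_enorm x)%E.
Proof.
rewrite lp_enorm.unlock.
have e n : ((modulus ((a *: x) n) `^ p)%:E =
    (modulus a `^ p)%:E * (modulus (x n) `^ p)%:E)%E.
  by rewrite -EFinM -powRM ?modulus_ge0// -modulusM.
under eq_eseriesr do rewrite e.
rewrite nneseriesZl; last by move=> n _; rewrite lee_fin powR_ge0.
rewrite poweRM ?lee_fin ?powR_ge0//; last first.
  by apply: nneseries_ge0 => n _ _; rewrite lee_fin powR_ge0.
by rewrite poweR_EFin -powRrM mulfV ?gt_eqF// powRr1 ?modulus_ge0.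
Qed.

Lemma lp_enorm0 : lp_enorm 0 = 0%E.
Proof.
by rewrite -(scale0r 0) lp_enormZ modulus0 mul0e.
Qed.

Lemma finite_lp_norm_submod : submod_closed finite_lp_norm.
Proof.
split; first by apply/asboolP; rewrite lp_enorm0.
move=> a x y /asboolP xoo /asboolP yoo; apply/asboolP.
apply: le_lt_trans (lp_enormD _ _) _; rewrite lp_enormZ.
by rewrite lte_add_pinfty// lte_mul_pinfty// ?lee_fin ?modulus_ge0.
Qed.

HB.instance Definition _ :=
  GRing.isSubmodClosed.Build _ _ finite_lp_norm finite_lp_norm_submod.
HB.instance Definition _ := [SubChoice_isSubLmodule of lp by <:].

Definition lp_norm (x : lp) : R := fine (lp_enorm x).

Lemma lp_normE x : (lp_norm x)%:E = lp_enorm x.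
Proof.
rewrite fineK// ge0_fin_numE ?lp_enorm_ge0//; apply/asboolP; exact: (valP x).
Qed.

Lemma lp_normD x y : lp_norm (x + y) <= lp_norm x + lp_norm y.
Proof. by rewrite -lee_fin EFinD !lp_normE; exact: lp_enormD. Qed.

Lemma lp_normZ a x : lp_norm (a *: x) = modulus a * lp_norm x.
Proof.
by apply: EFin_inj; rewrite [RHS]EFinM !lp_normE [LHS]lp_enormZ.
Qed.

Lemma lp_norm_eq0 x : lp_norm x = 0 -> x = 0.
Proof.
have sge0 : (0 <= \sum_(n <oo) (modulus (x n) `^ p)%:E)%E.
  by apply: nneseries_ge0 => n _ _; rewrite lee_fin powR_ge0.
move=> x0; have := lp_normE x; rewrite x0 lp_enorm.unlock => /esym h.
have s0 := poweR_eq0_eq0 sge0 h.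
apply: val_inj; apply: funext => n.
apply: modulus_eq0; apply: (@powR_eq0_eq0 _ _ p).
apply/eqP; rewrite eq_le powR_ge0 andbT -lee_fin -[X in (_ <= X)%E]s0.
rewrite (@nneseriesD1 _ _ n)//; last by move=> i _; rewrite lee_fin powR_ge0.
by rewrite leeDl// nneseries_ge0// => i _ _; rewrite lee_fin powR_ge0.
Qed.

Lemma lp_normMn x n : lp_norm (x *+ n) = lp_norm x *+ n.
Proof. by rewrite -scaler_nat lp_normZ modulus_natr mulr_natl. Qed.

Lemma lp_normN x : lp_norm (- x) = lp_norm x.
Proof. by rewrite -scaleN1r lp_normZ modulusN modulus1 mul1r. Qed.

HB.instance Definition _ := Num.Zmodule_isNormed.Build R lp
  lp_normD lp_norm_eq0 lp_normMn lp_normN.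
End lp_space.

Definition bounded_linear (R : realType) (k : scalar_kind) (p : R)
    (p1 : 1 <= p) : {pred lp k p1 -> lp k p1} :=
  fun a => `[< linear a /\ exists M : R, forall x, `|a x| <= M * `|x| >].

Record bounded_op (R : realType) (k : scalar_kind) (p : R) (p1 : 1 <= p) :=
  BoundedOp { bop_fun :> lp k p1 -> lp k p1;
              _ : bop_fun \in @bounded_linear R k p p1 }.

HB.lock Definition op_norm (R : realType) (k : scalar_kind) (p : R)
    (p1 : 1 <= p) (a : bounded_op k p1) : R :=
  sup [set `|a x| | x in [set x : lp k p1 | `|x| <= 1]].

Section bounded_operators.
Context {R : realType} {k : scalar_kind} {p : R} {p1 : 1 <= p}.
Local Notation lp := (@lp R k p p1).
Local Notation bounded_linear := (@bounded_linear R k p p1).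
Local Notation L := (@bounded_op R k p p1).

HB.instance Definition _ := [isSub of L for @bop_fun R k p p1].
HB.instance Definition _ := [Equality of L by <:].
HB.instance Definition _ := [Choice of L by <:].

Lemma lp_norm_scale (c : scalar R k) (x : lp) : `|c *: x| = modulus c * `|x|.
Proof. exact: lp_normZ. Qed.

Lemma bounded_linear_submod : submod_closed bounded_linear.
Proof.
split.
  apply/asboolP; split; first by move=> c x y; rewrite scaler0 addr0.
  by exists 0 => x; rewrite normr0 mul0r.
move=> c a b /asboolP[la [M aM]] /asboolP[lb [N bN]]; apply/asboolP; split.
  move=> d x y; rewrite !fctE/= la lb !scalerDr !scalerA (mulrC c) -!addrA.
  by congr (_ + _); rewrite addrCA.
exists (modulus c * M + N) => x; apply: le_trans (ler_normD _ _) _.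
rewrite mulrDl lerD// lp_norm_scale -mulrA.
by apply: ler_wpM2l; rewrite ?modulus_ge0.
Qed.

HB.instance Definition _ :=
  GRing.isSubmodClosed.Build _ _ bounded_linear bounded_linear_submod.
HB.instance Definition _ := [SubChoice_isSubLmodule of L by <:].

Lemma bopP (a : L) : linear a /\ exists M : R, forall x, `|a x| <= M * `|x|.
Proof. exact/asboolP/(valP a). Qed.

Lemma bopZ (a : L) c x : a (c *: x) = c *: a x.
Proof.
have [la _] := bopP a.
have a0 : a 0 = 0 by have := la (-1) 0 0; rewrite scaler0 addr0 scaleN1r addNr.
by have := la c x 0; rewrite !addr0 a0 addr0.
Qed.

Lemma bopD (a : L) x y : a (x + y) = a x + a y.
Proof. by have [la _] := bopP a; have := la 1 x y; rewrite !scale1r. Qed.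

Lemma op_norm_has_sup (a : L) :
  has_sup [set `|a x| | x in [set x : lp | `|x| <= 1]].
Proof.
have [_ [M aM]] := bopP a; split.
  by exists `|a 0|, 0 => //=; rewrite normr0.
exists `|M| => _ [x /= x1 <-]; apply: le_trans (aM x) _.
apply: le_trans (ler_wpM2r (normr_ge0 x) (ler_norm M)) _.
by rewrite ler_piMr.
Qed.

Definition scalar_of : R -> scalar R k :=
  match k return R -> scalar R k with
  | RealScalars => id
  | ComplexScalars => fun r => r%:C%C
  end.

Lemma modulus_scalar_of r : modulus (scalar_of r) = `|r|.
Proof.
rewrite /scalar_of; case: k => //.
by rewrite modulus_complexE /= expr0n addr0 sqrtr_sqr.
Qed.

Lemma op_normP (a : L) x : `|a x| <= op_norm a * `|x|.
Proof.
have [/eqP|x0] := eqVneq `|x| 0.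
  rewrite normr_eq0 => /eqP ->.
  by rewrite -(scale0r (0 : lp)) bopZ !lp_norm_scale modulus0 !mul0r mulr0.
have x_gt0 : 0 < `|x| by rewrite lt_neqAle eq_sym x0 normr_ge0.
rewrite -ler_pdivrMr// mulrC.
have <- : `|a (scalar_of `|x|^-1 *: x)| = `|x|^-1 * `|a x|.
  by rewrite bopZ lp_norm_scale modulus_scalar_of gtr0_norm ?invr_gt0.
rewrite op_norm.unlock; apply: sup_upper_bound; first exact: op_norm_has_sup.
exists (scalar_of `|x|^-1 *: x) => //=.
by rewrite lp_norm_scale modulus_scalar_of gtr0_norm ?invr_gt0// mulVf.
Qed.

Lemma op_norm_le (a : L) M : 0 <= M -> (forall x, `|a x| <= M * `|x|) ->
  op_norm a <= M.
Proof.
move=> M0 aM; rewrite op_norm.unlock; apply: sup_le_ub.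
  by have [] := op_norm_has_sup a.
by move=> _ [x /= x1 <-]; apply: le_trans (aM x) _; rewrite ler_piMr.
Qed.

Lemma op_norm_ge0 (a : L) : 0 <= op_norm a.
Proof.
apply: (le_trans (normr_ge0 (a 0))).
rewrite op_norm.unlock; apply: sup_upper_bound; first exact: op_norm_has_sup.
by exists 0 => //=; rewrite normr0.
Qed.

Lemma op_normD (a b : L) : op_norm (a + b) <= op_norm a + op_norm b.
Proof.
apply: op_norm_le => [|x]; first by rewrite addr_ge0 ?op_norm_ge0.
by apply: le_trans (ler_normD _ _) _; rewrite mulrDl lerD ?op_normP.
Qed.

Lemma op_norm_scale_le c (a : L) : op_norm (c *: a) <= modulus c * op_norm a.
Proof.
apply: op_norm_le => [|x]; first by rewrite mulr_ge0 ?modulus_ge0 ?op_norm_ge0.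
rewrite [(c *: a) x]/(c *: a x) lp_norm_scale -mulrA.
by rewrite ler_wpM2l ?modulus_ge0 ?op_normP.
Qed.

Lemma op_norm_scale c (a : L) : op_norm (c *: a) = modulus c * op_norm a.
Proof.
apply/eqP; rewrite eq_le op_norm_scale_le/=.
have [->|c0] := eqVneq c 0; first by rewrite modulus0 mul0r op_norm_ge0.
have mc0 : 0 < modulus c.
  rewrite lt_neqAle modulus_ge0 andbT eq_sym.
  by apply: contra c0 => /eqP/modulus_eq0/eqP.
rewrite -ler_pdivlMl//.
have -> : (modulus c)^-1 = modulus c^-1.
  rewrite -[RHS]mul1r -(mulVf (lt0r_neq0 mc0)) -mulrA -modulusM mulfV//.
  by rewrite modulus1 mulr1.
apply: le_trans (op_norm_scale_le _ _).
by rewrite scalerA mulVf// scale1r.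
Qed.

Lemma op_norm_eq0 (a : L) : op_norm a = 0 -> a = 0.
Proof.
move=> a0; apply: val_inj; apply: funext => x; apply/eqP; rewrite -normr_le0.
by apply: le_trans (op_normP a x) _; rewrite a0 mul0r.
Qed.

Lemma op_normMn (a : L) n : op_norm (a *+ n) = op_norm a *+ n.
Proof. by rewrite -scaler_nat op_norm_scale modulus_natr mulr_natl. Qed.

Lemma op_normN (a : L) : op_norm (- a) = op_norm a.
Proof. by rewrite -scaleN1r op_norm_scale modulusN modulus1 mul1r. Qed.

HB.instance Definition _ := Num.Zmodule_isNormed.Build R L
  op_normD op_norm_eq0 op_normMn op_normN.
HB.instance Definition _ := PseudoMetric.copy L (pseudoMetric_normed L).
HB.instance Definition _ := isPointed.Build L 0.
HB.instance Definition _ := NormedZmod_PseudoMetric_eq.Build R L erefl.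
HB.instance Definition _ :=
  PreTopologicalNmodule_isTopologicalNmodule.Build L
    (@pseudometric_normed_Zmodule.add_continuous R L).
HB.instance Definition _ :=
  TopologicalNmodule_isTopologicalZmodule.Build L
    (@pseudometric_normed_Zmodule.opp_continuous R L).

Lemma bounded_linear_id : idfun \in bounded_linear.
Proof. by apply/asboolP; split=> //; exists 1 => x; rewrite mul1r. Qed.

Lemma bounded_linear_comp (b a : L) : (b \o a : lp -> lp) \in bounded_linear.
Proof.
apply/asboolP; split; first by move=> c x y; rewrite /= bopD bopZ bopD bopZ.
exists (op_norm b * op_norm a) => x /=.
apply: le_trans (op_normP _ _) _; rewrite -mulrA.
by rewrite ler_wpM2l ?op_norm_ge0 ?op_normP.
Qed.
End bounded_operators.

Definition Lbullet (R : realType) (k : scalar_kind) (p : R) (p1 : 1 <= p) :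
  Type := bounded_op k p1.

Section Lbullet.
Context {R : realType} {k : scalar_kind} {p : R} {p1 : 1 <= p}.
Local Notation L := (@Lbullet R k p p1).

HB.instance Definition _ := GRing.Lmodule.on L.
HB.instance Definition _ := PseudoMetricNormedZmod.on L.
HB.instance Definition _ := TopologicalZmodule.on L.

Definition bullet (a b : L) : L :=
  @BoundedOp R k p p1 (fun x => b (a x)) (bounded_linear_comp b a).

Definition bullet_one : L := BoundedOp bounded_linear_id.

Lemma bulletA : associative bullet.
Proof. by move=> a b c; apply: val_inj. Qed.

Lemma bullet1l : left_id bullet_one bullet.
Proof. by move=> a; apply: val_inj. Qed.

Lemma bullet1r : right_id bullet_one bullet.
Proof. by move=> a; apply: val_inj. Qed.

Lemma bulletDl : left_distributive bullet +%R.
Proof.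
by move=> a b c; apply: val_inj; apply: funext => x; exact: bopD.
Qed.

Lemma bulletDr : right_distributive bullet +%R.
Proof. by move=> a b c; apply: val_inj. Qed.

HB.instance Definition _ := GRing.Zmodule_isPzRing.Build L
  bulletA bullet1l bullet1r bulletDl bulletDr.

Lemma bulletE (a b : L) x : (a * b) x = b (a x).
Proof. by []. Qed.

Lemma Lbullet_normE (a : L) :
  `|a| = sup [set `|a x| | x in [set x : lp k p1 | `|x| <= 1]].
Proof. by rewrite -[LHS]/(op_norm a) op_norm.unlock. Qed.

Lemma ler_normM_bullet (a b : L) : `|a * b| <= `|a| * `|b|.
Proof.
apply: op_norm_le => [|x]; first by rewrite mulr_ge0.
apply: le_trans (op_normP b (a x)) _.
rewrite -[leRHS]/(op_norm a * op_norm b * `|x|).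
rewrite (mulrC (op_norm a)) -mulrA.
by apply: ler_wpM2l; [exact: op_norm_ge0|exact: op_normP].
Qed.

Lemma bullet_continuous : continuous (fun z : L * L => z.1 * z.2).
Proof.
move=> [a b] /=; apply/cvgrPdist_lt => e e0.
pose d := Num.min 1 (e / (`|a| + `|b| + 1 + 1)).
have s0 : 0 < `|a| + `|b| + 1 + 1 by rewrite ltr_wpDl// addr_ge0// addr_ge0.
have d0 : 0 < d by rewrite lt_min ltr01 divr_gt0.
near=> z.
have za : `|a - z.1| < d.
  by near: z; apply: (@cvgr_dist_lt _ _ _ _ _ fst a) => //; exact: cvg_fst.
have zb : `|b - z.2| < d.
  by near: z; apply: (@cvgr_dist_lt _ _ _ _ _ snd b) => //; exact: cvg_snd.
have -> : a * b - z.1 * z.2 = (a - z.1) * z.2 + a * (b - z.2).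
  by rewrite mulrBl mulrBr [RHS]addrC addrA subrK.
apply: le_lt_trans (ler_normD _ _) _.
have h1 : `|(a - z.1) * z.2| <= d * (`|b| + 1).
  apply: le_trans (ler_normM_bullet _ _) _.
  apply: ler_pM => //; first exact: ltW.
  rewrite -[z.2](subrK b) addrC; apply: le_trans (ler_normD _ _) _.
  by rewrite lerD2l distrC ltW// (lt_le_trans zb)// ge_min lexx.
have h2 : `|a * (b - z.2)| <= d * `|a|.
  apply: le_trans (ler_normM_bullet _ _) _.
  by rewrite mulrC ler_wpM2r// ltW.
apply: le_lt_trans (lerD h1 h2) _; rewrite -mulrDr.
apply: lt_le_trans (_ : d * (`|a| + `|b| + 1 + 1) <= _).
  by rewrite ltr_pM2l// addrC addrA ltrDl.
by rewrite -ler_pdivlMr// ge_min lexx orbT.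
Unshelve. all: by end_near. Qed.

HB.instance Definition _ := isTopologicalRing.Build L bullet_continuous.
End Lbullet.

(* Main.v *)
Require Import Defs.
From mathcomp Require Import all_boot all_order all_algebra finmap.
From mathcomp Require Import all_classical all_reals all_analysis.
Import Order.TTheory GRing.Theory Num.Theory.
Import numFieldNormedType.Exports.

Set Implicit Arguments.
Unset Strict Implicit.
Unset Printing Implicit Defensive.

Local Open Scope classical_set_scope.
Local Open Scope ring_scope.

(** Let [c_n = (n + 1) ^ (- 1 / p)] and let [x_n] be the diagonal operator
    [c_n e_n e_n^*]. A diagonal operator has norm at most the supremum of its
    entries, so [c_n -> 0] makes [\sum_n x_n] unconditionally convergent.
    The rank one operators [a_n = e e_n e_0^*] have norm at most [e], while
    [a_n * x_n], which is "first [a_n], then [x_n]", sends [e_0] to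
    [e c_n e_n]. Hence the norm of [\sum_(n < N) a_n * x_n] to the power [p] is
    at least [e ^ p \sum_(n < N) 1 / (n + 1)], which is unbounded in [N]. *)

(** * Entrywise estimates in [lp] *)

Section lp_norms.
Context {R : realType} {k : scalar_kind} {p : R} {p1 : 1 <= p}.
Local Notation F := (Defs.scalar R k).
Local Notation lp := (lp k p1).

Let p0 : 0 < p. Proof. exact: lt_le_trans p1. Qed.

Lemma le_lp_enorm (x y : nat -> F) :
  (forall n, modulus (x n) <= modulus (y n)) ->
  (lp_enorm p x <= lp_enorm p y)%E.
Proof.
move=> xy; have s0 (z : nat -> F) :
    (0 <= \sum_(n <oo) (modulus (z n) `^ p)%:E)%E.
  by apply: nneseries_ge0 => n _ _; rewrite lee_fin powR_ge0.
rewrite lp_enorm.unlock; apply: gt0_ler_poweR.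
- by rewrite invr_ge0 ltW.
- by rewrite in_itv/= leey andbT.
- by rewrite in_itv/= leey andbT.
apply: lee_nneseries => n _; first by rewrite lee_fin powR_ge0.
by rewrite lee_fin ge0_ler_powR ?nnegrE ?modulus_ge0 ?(ltW p0).
Qed.

Lemma lp_norm_le_scaled (M : R) (x y : lp) : 0 <= M ->
  (forall n, modulus (x n) <= M * modulus (y n)) -> `|x| <= M * `|y|.
Proof.
move=> M0 xy.
(* Writing [M] as the modulus of [scalar_of M] turns the right side into the norm of
   [scalar_of M *: y], so monotonicity of [lp_enorm] applies. *)
rewrite -[M in leRHS]ger0_norm// -(modulus_scalar_of (k := k)) -lp_norm_scale.
rewrite -lee_fin !lp_normE; apply: le_lp_enorm => n.
by rewrite [leRHS](modulusM (scalar_of M)) modulus_scalar_of ger0_norm.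
Qed.

Lemma lp_normXp (x : lp) :
  (\sum_(n <oo) (modulus (x n) `^ p)%:E)%E = (`|x| `^ p)%:E.
Proof.
rewrite -poweR_EFin lp_normE lp_enorm.unlock -poweRrM mulVf ?gt_eqF//.
by rewrite poweRe1// nneseries_ge0// => n _ _; rewrite lee_fin powR_ge0.
Qed.

Lemma lp_norm_ge_partial_sum (x : lp) N :
  \sum_(0 <= n < N) modulus (x n) `^ p <= `|x| `^ p.
Proof.
rewrite -lee_fin -sumEFin -lp_normXp; apply: nneseries_lim_ge => n _ _.
by rewrite lee_fin powR_ge0.
Qed.

Definition unit_seq (n : nat) : nat -> F := fun m => (m == n)%:R.

Lemma lp_enorm_unit_seq n : lp_enorm p (unit_seq n) = 1%E.
Proof.
rewrite lp_enorm.unlock (nneseriesD1 (n := n))//; last first.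
  by move=> m _; rewrite lee_fin powR_ge0.
rewrite /unit_seq eqxx modulus1 powR1 eseries0.
  by rewrite adde0 poweR_EFin powR1.
by move=> m _ /negPf ->; rewrite modulus0 powR0 ?gt_eqF.
Qed.

Lemma unit_seq_finite n : unit_seq n \in @finite_lp_norm R k p p1.
Proof. by apply/asboolP; rewrite lp_enorm_unit_seq ltry. Qed.

Definition unit_vec n : lp := Lp (unit_seq_finite n).

Lemma lp_norm_unit_vec n : `|unit_vec n| = 1.
Proof. by apply: EFin_inj; rewrite lp_normE lp_enorm_unit_seq. Qed.

(** The vector [x n *: unit_vec n] has norm [modulus (x n)] and is dominated entrywise by [x]. *)
Lemma modulus_le_lp_norm (x : lp) n : modulus (x n) <= `|x|.
Proof.
have -> : modulus (x n) = `|x n *: unit_vec n|.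
  by rewrite lp_norm_scale lp_norm_unit_vec mulr1.
rewrite -[leRHS]mul1r; apply: lp_norm_le_scaled => // m; rewrite mul1r.
rewrite [leLHS](modulusM (x n)) modulus_natr.
by case: eqP => [->|_]; rewrite ?mulr1// mulr0 modulus_ge0.
Qed.

End lp_norms.

(** * Diagonal and rank one operators *)

Section operators.
Context {R : realType} {k : scalar_kind} {p : R} {p1 : 1 <= p}.
Local Notation F := (Defs.scalar R k).
Local Notation lp := (lp k p1).
Local Notation L := (Lbullet k p1).

Lemma Lbullet_sumE (r : seq nat) (a : nat -> L) (x : lp) m :
  (\sum_(i <- r) a i) x m = \sum_(i <- r) a i x m.
Proof. by rewrite (big_morph (fun b : L => b x m) (id1 := 0) (op1 := +%R)). Qed.

Section diagonal.
Variable c : nat -> F.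
Hypothesis c1 : forall n, modulus (c n) <= 1.

Lemma diag_finite (x : lp) :
  (fun n => c n * x n) \in @finite_lp_norm R k p p1.
Proof.
have /asboolP xoo := valP x.
apply/asboolP; apply: le_lt_trans xoo; apply: (le_lp_enorm (p1 := p1)) => n.
by rewrite modulusM ler_piMl ?modulus_ge0.
Qed.

Definition diag_fun (x : lp) : lp := Lp (diag_finite x).

Lemma diag_bounded_linear : diag_fun \in @bounded_linear R k p p1.
Proof.
apply/asboolP; split.
  move=> a x y; apply: val_inj; apply: funext => n /=.
  by rewrite [LHS]mulrDr mulrCA.
exists 1 => x; apply: lp_norm_le_scaled => // n.
by rewrite mul1r modulusM ler_piMl ?modulus_ge0.
Qed.

Definition diag_op : L := BoundedOp diag_bounded_linear.

End diagonal.

Lemma rank_one_bounded_linear (n : nat) (e : F) :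
  (fun x : lp => (e * x 0%N) *: unit_vec n) \in @bounded_linear R k p p1.
Proof.
apply/asboolP; split.
  by move=> a x y; rewrite scalerA mulrCA -scalerDl -mulrDr.
exists (modulus e) => x; rewrite lp_norm_scale lp_norm_unit_vec mulr1 modulusM.
by rewrite ler_wpM2l ?modulus_ge0 ?modulus_le_lp_norm.
Qed.

Definition rank_one_op n e : L := BoundedOp (rank_one_bounded_linear n e).

Lemma norm_rank_one_op_le n e : `|rank_one_op n e| <= modulus e.
Proof.
apply: op_norm_le => [|x]; first exact: modulus_ge0.
rewrite lp_norm_scale lp_norm_unit_vec mulr1 modulusM.
by rewrite ler_wpM2l ?modulus_ge0 ?modulus_le_lp_norm.
Qed.

End operators.

(** Serves to read a finite sum of operators at coordinate [i], where only the operator of index [i]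
    contributes. *)
Lemma sumr_if_eq_seq (V : nmodType) (r : seq nat) (g : nat -> V) i : uniq r ->
  \sum_(n <- r) (if n == i then g n else 0) = if i \in r then g i else 0.
Proof.
move=> ur; case: ifPn => ir.
  by rewrite (bigD1_seq i)//= eqxx big1 ?addr0// => n /negPf ->.
by rewrite big_seq big1// => n nr; case: eqP => // ni; rewrite -ni nr in ir.
Qed.

(** * The convergent series and its perturbed sums *)

Section weights.
Context (R : realType) (k : scalar_kind) (p : R) (p1 : 1 <= p).
Local Notation F := (Defs.scalar R k).
Local Notation L := (Lbullet k p1).

Let p0 : 0 < p. Proof. exact: lt_le_trans p1. Qed.

Definition weight (n : nat) : F := scalar_of (harmonic n `^ p^-1).

Lemma modulus_weight n : modulus (weight n) = harmonic n `^ p^-1.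
Proof. by rewrite modulus_scalar_of ger0_norm ?powR_ge0. Qed.

Lemma modulus_weightXp n : modulus (weight n) `^ p = harmonic n.
Proof.
by rewrite modulus_weight -powRrM mulVf ?gt_eqF// powRr1 ?harmonic_ge0.
Qed.

Lemma modulus_weight_le1 n : modulus (weight n) <= 1.
Proof.
rewrite modulus_weight [leRHS](_ : 1 = 1 `^ p^-1); last by rewrite powR1.
rewrite ge0_ler_powR ?nnegrE ?invr_ge0 ?(ltW p0)//.
by rewrite invf_le1 ?ltr0n// ler1n.
Qed.

(** The harmonic sequence is eventually at most [e ^ p]; taking [p]-th roots gives the bound. *)
Lemma weight_small (e : R) : 0 < e ->
  exists N, forall n, (N <= n)%N -> modulus (weight n) <= e.
Proof.
move=> e0; have /cvgr0_norm_le/(_ _ (powR_gt0 p e0))[N _ NP] := @cvg_harmonic R.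
exists N => n /NP; rewrite /= ger0_norm ?invr_ge0// modulus_weight => ne.
have -> : e = (e `^ p) `^ p^-1 by rewrite -powRrM mulfV ?gt_eqF// powRr1 ?ltW.
by rewrite ge0_ler_powR ?nnegrE ?invr_ge0 ?powR_ge0 ?(ltW p0).
Qed.

(** Encoding the single entry as a whole diagonal lets the terms and the sum of the series share
    [diag_op]. *)
Definition weight_at (n i : nat) : F := if n == i then weight n else 0.

Lemma modulus_weight_at_le1 n i : modulus (weight_at n i) <= 1.
Proof.
by rewrite /weight_at; case: ifP; rewrite ?modulus_weight_le1 ?modulus0.
Qed.

Definition term n : L := diag_op (modulus_weight_at_le1 n).

(** The sum is the diagonal operator of all weights. Its difference from the partial sum over [J] is
    diagonal, supported outside [J], where the weights are small once [J] contains all indices below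
    [N]. *)
Lemma term_sum_unconditional : unconditionally_convergent term.
Proof.
exists (diag_op modulus_weight_le1) => U /nbhs_normP[e /= e0 eU].
(* The weights are bounded by [e / 2] because the norm estimates are non-strict while the ball in
   [U] is open. *)
have [N Ne] := weight_small (divr_gt0 e0 (ltr0n R 2)).
exists [fset n in iota 0 N]%fset => J /fsubsetP NJ.
set l := diag_op _; exists (\sum_(n <- J) term n - l); last first.
  by rewrite addrC subrK.
apply: eU; rewrite /= sub0r normrN.
apply: (@le_lt_trans _ _ (e / 2)); last first.
  by rewrite ltr_pdivrMr// ltr_pMr// ltr1n.
apply: op_norm_le => [|x]; first by rewrite divr_ge0 ?ltW.
apply: lp_norm_le_scaled => [|i]; first by rewrite divr_ge0 ?ltW.
have -> : (\sum_(n <- J) term n - l) x i =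
    (if i \in J then weight i * x i else 0) - weight i * x i.
  rewrite -(sumr_if_eq_seq (fun n => weight n * x n) i (fset_uniq J)).
  rewrite [LHS](_ : _ = (\sum_(n <- J) term n) x i - l x i)// Lbullet_sumE.
  congr (_ - _); apply: eq_bigr => n _ /=; rewrite /weight_at.
  by case: eqP => [->//|_]; rewrite mul0r.
case: ifPn => iJ.
  by rewrite subrr modulus0 mulr_ge0 ?modulus_ge0// divr_ge0 ?ltW.
rewrite sub0r modulusN modulusM ler_wpM2r ?modulus_ge0// Ne// leqNgt.
by apply: contra iJ => iN; apply: NJ; rewrite !inE mem_iota.
Qed.

(** Evaluating at [unit_vec 0] yields a vector whose entry at [i < N] is [weight i * e]; its modulus
    to the power [p] is [e ^ p] times the [i]-th harmonic term. *)
Lemma le_norm_rank_one_term_sum N (e : R) : 0 < e ->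
  e `^ p * series harmonic N <=
  `|\sum_(n <- [fset n in iota 0 N]%fset)
     rank_one_op n (scalar_of e) * term n| `^ p.
Proof.
move=> e0; set b := \sum_(n <- _) _.
have be : `|b (unit_vec 0)| <= `|b|.
  by apply: le_trans (op_normP b _) _; rewrite lp_norm_unit_vec mulr1.
apply: (@le_trans _ _ (`|b (unit_vec 0)| `^ p)); last first.
  by rewrite ge0_ler_powR ?nnegrE ?(ltW p0).
apply: le_trans (lp_norm_ge_partial_sum _ N).
rewrite /series /= mulr_sumr !big_mkord.
apply: ler_sum => -[i /= iN] _; rewrite Lbullet_sumE.
rewrite (eq_bigr (fun n => if n == i then weight n * scalar_of e else 0));
  last first.
  move=> n _ /=; rewrite /weight_at.
  case: eqP => [->|_]; last by rewrite mul0r.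
  (* Entry [0] of [unit_vec 0] and entry [i] of [unit_vec i] are both 1. *)
  by congr (_ * _); rewrite /= [LHS]mulrC /unit_seq eqxx mul1r mulr1.
rewrite sumr_if_eq_seq ?fset_uniq// !inE mem_iota/= iN.
rewrite modulusM modulus_scalar_of ger0_norm ?(ltW e0)//.
by rewrite powRM ?modulus_ge0 ?(ltW e0)// modulus_weightXp mulrC.
Qed.

End weights.

(** The partial sums are nondecreasing, so a bound would make the divergent series converge. *)
Lemma harmonic_series_unbounded (R : realType) (M : R) :
  exists N, M < series harmonic N.
Proof.
apply: contrapT => /forallNP NM; apply: (@dvg_harmonic R).
apply: nondecreasing_is_cvgn.
  apply/nondecreasing_seqP => n.
  by rewrite seriesEnat /= big_nat_recr//= lerDl invr_ge0.
by exists M => _ [n _ <-]; rewrite leNgt; apply/negP.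
Qed.

Theorem proposition7p7 (R : realType) (k : scalar_kind) (p : R)
  (p1 : (1 <= p)%R) : ~ Hirsch (Lbullet k p1).
Proof.
move=> /(_ _ (term_sum_unconditional k p1)).
move=> /(_ [set a | `|a| < 1]) [|V].
  by apply/nbhs_normP; exists 1 => //= a; rewrite /= sub0r normrN.
move=> /nbhs_normP[e /= e0 eV] sumV.
have d0 : 0 < e / 2 by rewrite divr_gt0.
(* This threshold makes the lower bound for the [p]-th power of the norm exceed 1, whereas rank one
   operators of size [e / 2] lie in [V] and force norm below 1. *)
have [N] := harmonic_series_unbounded ((e / 2) `^ p)^-1.
rewrite ltNge => /negP; apply.
rewrite -[leRHS]mulr1 ler_pdivlMl ?powR_gt0//.
apply: le_trans (le_norm_rank_one_term_sum k p1 N d0) _.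
rewrite [leRHS](_ : 1 = 1 `^ p); last by rewrite powR1.
rewrite ge0_ler_powR ?nnegrE// ?ltW ?(lt_le_trans _ p1)//.
apply: sumV => n _; apply: eV; rewrite /= sub0r normrN.
apply: le_lt_trans (norm_rank_one_op_le _ _) _.
by rewrite modulus_scalar_of gtr0_norm// ltr_pdivrMr// ltr_pMr// ltr1n.
Qed.
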